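(* The following two assertions are equivalent: (1) every graph $G$ satisfies $\vartheta\text{-rank}(G)<\infty$; (2) for every graph $G$, $\vartheta\text{-rank}(G)<\infty$ implies $\vartheta\text{-rank}(G\oplus i_0)<\infty$, where $G\oplus i_0$ is the graph obtained from $G$ by adding one new isolated node $i_0$.
   Context: All graphs are finite and simple with nonempty vertex set. For a graph $G=(V=[n],E)$, $\alpha(G)$ is the maximum cardinality of a stable (independent) set, $A_G$ is the adjacency matrix, $I$ the identity and $J$ the all-ones matrix. For $r\in\mathbb N=\{0,1,\dots\}$, $\mathcal K_n^{(r)}$ is the set of real symmetric $n\times n$ matrices $M$ such that $(\sum_{i=1}^n x_i^2)^r\sum_{i,j=1}^n M_{ij}x_i^2x_j^2$ is a sum of squares of real polynomials, and $\vartheta^{(r)}(G)=\min\{t: t(A_G+I)-J\in\mathcal K_n^{(r)}\}$. The $\vartheta$-rank of $G$, $\vartheta\text{-rank}(G)$, is the smallest $r\in\mathbb N$ with $\vartheta^{(r)}(G)=\alpha(G)$ (equivalently, with $\alpha(G)(A_G+I)-J\in\mathcal K_n^{(r)}$), and $\infty$ if no such $r$ exists. *)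

(* Defs.v *)
From mathcomp Require Import all_boot all_order all_algebra.
From mathcomp Require Import mpoly.
From mathcomp Require Import boolp classical_sets reals.

Set Implicit Arguments.
Unset Strict Implicit.
Unset Printing Implicit Defensive.

Import Order.TTheory GRing.Theory Num.Theory.
Local Open Scope ring_scope.
Local Open Scope classical_set_scope.

(* Graphs with vertex set 'I_n; n = 0 is not excluded here. *)
Record sgraph (n : nat) := SGraph {
  adj : rel 'I_n;
  adj_sym : ssrbool.symmetric adj;
  adj_irr : irreflexive adj }.

Definition stable n (G : sgraph n) (S : {set 'I_n}) : bool :=
  [forall i in S, forall j in S, ~~ adj G i j].

Definition alpha n (G : sgraph n) : nat :=
  \max_(S : {set 'I_n} | stable G S) #|S|.

Section AddIsolated.
Variables (n : nat) (G : sgraph n).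

Definition add_isolated_adj : rel 'I_n.+1 := fun i j =>
  match unlift ord_max i, unlift ord_max j with
  | Some i', Some j' => adj G i' j'
  | _, _ => false
  end.

Lemma add_isolated_sym : ssrbool.symmetric add_isolated_adj.
Proof.
move=> i j; rewrite /add_isolated_adj.
by case: (unlift ord_max i) (unlift ord_max j) => [i'|] [j'|] //; apply: adj_sym.
Qed.

Lemma add_isolated_irr : irreflexive add_isolated_adj.
Proof.
move=> i; rewrite /add_isolated_adj.
by case: (unlift ord_max i) => [i'|] //; apply: adj_irr.
Qed.

(* The new isolated node is ord_max; the old node i becomes lift ord_max i,
   which has the same value as i. *)
Definition add_isolated : sgraph n.+1 :=
  SGraph add_isolated_sym add_isolated_irr.

End AddIsolated.

Section Theta.
Variable R : realType.

Definition adjmx n (G : sgraph n) : 'M[R]_n := \matrix_(i, j) (adj G i j)%:R.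

Definition is_sos n (p : {mpoly R[n]}) : Prop :=
  exists s : seq {mpoly R[n]}, p = \sum_(q <- s) q ^+ 2.

Definition Kcone n (r : nat) : set 'M[R]_n :=
  [set M | M^T = M /\
    is_sos ((\sum_(i < n) 'X_i ^+ 2) ^+ r *
            (\sum_(i < n) \sum_(j < n) (M i j)%:MP * 'X_i ^+ 2 * 'X_j ^+ 2))].

(* The least element of A; the default value 0 is returned if there is none. *)
Definition minimum (A : set R) : R := xget 0 (A `&` lbound A).

Definition theta n (r : nat) (G : sgraph n) : R :=
  minimum [set t | Kcone r (t *: (adjmx G + 1%:M) - const_mx 1)].

(* The least natural number satisfying P, with None standing for infinity. *)
Definition least_nat (P : nat -> Prop) : option nat :=
  if pselect (exists r, `[< P r >]) is left exP then Some (ex_minn exP)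
  else None.

Definition theta_rank n (G : sgraph n) : option nat :=
  least_nat (fun r => theta r G = (alpha G)%:R).

Definition finite_theta_rank n (G : sgraph n) : Prop := theta_rank G <> None.

End Theta.

(* Main.v *)
(* By strong induction on the number of nodes, (2) reduces finiteness of the rank
   of G to that of all graphs H_i + i, where H_i is induced by the non-neighbours
   of a node i and i is isolated in H_i + i. Put y_i = x_i^2, s = sum_i y_i,
   a = alpha(G), and let Q_i be the form of a(A + I) - J for the graph H_i + i,
   with the variable of i replaced by the sum of y over the closed neighbourhood
   of i. Then s times the form of a(A_G + I) - J equals sum_i y_i Q_i plus a
   nonnegative combination of the cubic monomials y_i y_j y_k (one for each
   induced path j - i - k), while alpha(H_i + i) <= a. *)

Require Import Defs.
From mathcomp Require Import all_boot all_order all_algebra.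
From mathcomp Require Import mpoly ring.
From mathcomp Require Import boolp classical_sets reals.

Set Implicit Arguments.
Unset Strict Implicit.
Unset Printing Implicit Defensive.

Import Order.TTheory GRing.Theory Num.Theory.
Local Open Scope ring_scope.

(** * Closure properties of sums of squares *)

Section SumsOfSquares.
Variables (R : realType) (n : nat).
Implicit Types p q : {mpoly R[n]}.

Lemma sos0 : is_sos (0 : {mpoly R[n]}).
Proof. by exists [::]; rewrite big_nil. Qed.

Lemma sos_sqr p : is_sos (p ^+ 2).
Proof. by exists [:: p]; rewrite big_seq1. Qed.

Lemma sosD p q : is_sos p -> is_sos q -> is_sos (p + q).
Proof. by move=> [s ->] [t ->]; exists (s ++ t); rewrite big_cat. Qed.

Lemma sos_sum (I : Type) (r : seq I) (P : pred I) (F : I -> {mpoly R[n]}) :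
  (forall i, P i -> is_sos (F i)) -> is_sos (\sum_(i <- r | P i) F i).
Proof. by move=> sosF; apply: big_ind => //; [exact: sos0|exact: sosD]. Qed.

Lemma sosM p q : is_sos p -> is_sos q -> is_sos (p * q).
Proof.
move=> [s ->] [t ->]; rewrite mulr_suml; apply: sos_sum => i _.
rewrite mulr_sumr; apply: sos_sum => j _.
by rewrite -exprMn; apply: sos_sqr.
Qed.

Lemma sosC (c : R) : 0 <= c -> is_sos (c%:MP_[n]).
Proof. by move=> c0; rewrite -(sqr_sqrtr c0) rmorphXn; apply: sos_sqr. Qed.

Lemma sosX p k : is_sos p -> is_sos (p ^+ k).
Proof.
move=> sosp; elim: k => [|k IHk]; last by rewrite exprS; apply: sosM.
by rewrite expr0 -mpolyC1; apply: sosC.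
Qed.

Lemma sos_meval_ge0 p (v : 'I_n -> R) : is_sos p -> 0 <= p.@[v].
Proof.
move=> [s ->]; rewrite rmorph_sum /=; apply: sumr_ge0 => q _.
by rewrite rmorphXn /= sqr_ge0.
Qed.

End SumsOfSquares.

(** * The form defining the cone, over any commutative ring, and substitution into it *)

Section QuadraticForms.
Variables (R : realType) (m : nat).

(* Kcone r is about the case T = {mpoly R[m]}, y i = 'X_i ^+ 2. *)
Definition kpoly (T : comNzRingType) (c : R -> T) r (M : 'M[R]_m) (y : 'I_m -> T) :=
  (\sum_i y i) ^+ r * \sum_i \sum_j c (M i j) * y i * y j.

Lemma eq_kpoly (T : comNzRingType) (c c' : R -> T) r M (y y' : 'I_m -> T) :
  c =1 c' -> y =1 y' -> kpoly c r M y = kpoly c' r M y'.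
Proof.
move=> eq_c eq_y; rewrite /kpoly (eq_bigr _ (fun i _ => eq_y i)).
congr (_ * _); apply: eq_bigr => i _; apply: eq_bigr => j _.
by rewrite eq_c !eq_y.
Qed.

(** Taking coefficients and variables in an arbitrary ring lets this one fact serve [mmap], Horner
    evaluation and [meval] alike. *)
Lemma rmorph_kpoly (T T' : comNzRingType) (f : {rmorphism T -> T'})
    (c : R -> T) r M (y : 'I_m -> T) :
  f (kpoly c r M y) = kpoly (f \o c) r M (f \o y).
Proof.
rewrite /kpoly rmorphM rmorphXn !rmorph_sum; congr (_ * _).
apply: eq_bigr => i _; rewrite rmorph_sum; apply: eq_bigr => j _.
by rewrite !rmorphM.
Qed.

End QuadraticForms.

Lemma even_poly_comp_sqr (T : comNzRingType) (p : {poly T}) :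
  even_poly (p \Po 'X^2) = p.
Proof.
apply/polyP => i.
by rewrite coef_even_poly coef_comp_poly_Xn // -muln2 dvdn_mull // mulnK.
Qed.

(** Split p as e(X^2) + X o(X^2). The cross term 2 X e(X^2) o(X^2) of the square is odd and drops
    out. *)
Lemma even_poly_sqr (T : comNzRingType) (p : {poly T}) :
  even_poly (p ^+ 2) = even_poly p ^+ 2 + odd_poly p ^+ 2 * 'X.
Proof.
set e := even_poly p; set o := odd_poly p.
rewrite -[in LHS](poly_even_odd p) -/e -/o.
have -> : (e \Po 'X^2 + (o \Po 'X^2) * 'X) ^+ 2 =
    ((e ^+ 2 + o ^+ 2 * 'X) \Po 'X^2) + (((e * o *+ 2) \Po 'X^2) * 'X) :> {poly T}.
  by rewrite mulr2n !rmorphD !rmorphM /= comp_polyX; ring.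
rewrite even_polyD even_poly_comp_sqr even_polyMX.
suff -> : odd_poly ((e * o *+ 2) \Po 'X^2) = 0 by rewrite mul0r addr0.
apply/polyP => i; rewrite coef_odd_poly coef_comp_poly_Xn // coef0.
by rewrite dvdn2 /= odd_double.
Qed.

(* Writing q = e(x^2) + x o(x^2) in the last variable x, the even part of q^2
   is e(x^2)^2 + x^2 o(x^2)^2, which stays a sum of squares when x^2 is
   replaced by one. *)
Lemma sos_kpoly_subst (R : realType) m n r (M : 'M[R]_m.+1)
    (f : 'I_m -> {mpoly R[n]}) (y : 'I_m.+1 -> {mpoly R[n]}) :
  (forall j, y (lift ord_max j) = f j ^+ 2) -> is_sos (y ord_max) ->
  is_sos (kpoly (@mpolyC m.+1 R) r M (fun i => 'X_i ^+ 2)) ->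
  is_sos (kpoly (@mpolyC n R) r M y).
Proof.
move=> yE sos_s [s sE]; pose T := {mpoly R[n]}.
pose c : {rmorphism R -> {poly T}} := (polyC \o @mpolyC n R)%FUN.
pose k i : {poly T} := if unlift ord_max i is Some j then (f j)%:P else 'X.
pose y' i : {poly T} := if unlift ord_max i is Some j then (f j ^+ 2)%:P else 'X.
(* [k] keeps the last variable as ['X] and sends the others to the roots [f j]. The form involves
   variables only through their squares, so its image is a polynomial in X^2. *)
have phiE : mmap c k (kpoly (@mpolyC m.+1 R) r M (fun i => 'X_i ^+ 2)) =
    kpoly c r M y' \Po 'X^2.
  rewrite !rmorph_kpoly; apply: eq_kpoly => [a|i] /=.
    by rewrite mmapC /= comp_polyC.
  rewrite rmorphXn /= mmapX mmap1U /k /y'.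
  by case: unlift => [j|]; rewrite ?comp_polyX // comp_polyC rmorphXn.
have -> : kpoly (@mpolyC n R) r M y = (kpoly c r M y').[y ord_max].
  rewrite -[RHS]/(horner_eval (y ord_max) _) rmorph_kpoly.
  apply: eq_kpoly => [a|i] /=; first by rewrite /horner_eval hornerC.
  rewrite /horner_eval /y'; case: unliftP => [j|] ->; last by rewrite hornerX.
  by rewrite hornerC yE.
(* The even part undoes the composition with X^2. Being additive, it can be taken square by
   square. *)
rewrite -[kpoly c r M y']even_poly_comp_sqr -phiE sE rmorph_sum /= raddf_sum.
rewrite -[_.[_]]/(horner_eval (y ord_max) _) rmorph_sum /=.
apply: sos_sum => q _; rewrite rmorphXn even_poly_sqr /horner_eval.
rewrite hornerD hornerMX !horner_exp.
apply: sosD; first exact: sos_sqr.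
by apply: sosM => //; apply: sos_sqr.
Qed.

(** * The matrices t(A_G + I) - J, where A_G + I is the 0/1 matrix of [cadj] *)

Definition cadj n (G : sgraph n) : rel 'I_n := fun i j => (i == j) || adj G i j.

Lemma cadjC n (G : sgraph n) : ssrbool.symmetric (cadj G).
Proof. by move=> i j; rewrite /cadj eq_sym adj_sym. Qed.

Definition cadj_form n (T : comNzRingType) (G : sgraph n) (y : 'I_n -> T) : T :=
  \sum_i \sum_j (cadj G i j)%:R * y i * y j.

Definition theta_mx (R : realType) n (G : sgraph n) (t : R) : 'M[R]_n :=
  t *: (adjmx R G + 1%:M) - const_mx 1.

Lemma theta_mxE (R : realType) n (G : sgraph n) (t : R) i j :
  theta_mx G t i j = t * (cadj G i j)%:R - 1.
Proof.
rewrite !mxE /cadj; case: eqP => [->|_]; last by rewrite addr0.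
by rewrite adj_irr add0r.
Qed.

Lemma tr_theta_mx (R : realType) n (G : sgraph n) (t : R) :
  (theta_mx G t)^T = theta_mx G t.
Proof. by apply/matrixP => i j; rewrite mxE !theta_mxE cadjC. Qed.

Lemma kpoly_theta_mx (R : realType) n (T : comNzRingType) (c : {rmorphism R -> T})
    r (G : sgraph n) t (y : 'I_n -> T) :
  kpoly c r (theta_mx G t) y =
  (\sum_i y i) ^+ r * (c t * cadj_form G y - (\sum_i y i) ^+ 2).
Proof.
rewrite /kpoly; congr (_ * _).
rewrite /cadj_form mulr_sumr expr2 mulr_suml -sumrB; apply: eq_bigr => i _.
rewrite !mulr_sumr -sumrB; apply: eq_bigr => j _.
by rewrite theta_mxE rmorphB rmorphM rmorph1 rmorph_nat; ring.
Qed.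

Lemma Kcone_theta_mxE (R : realType) n r (G : sgraph n) (t : R) :
  Kcone r (theta_mx G t) <->
  is_sos (kpoly (@mpolyC n R) r (theta_mx G t) (fun i => 'X_i ^+ 2)).
Proof. by split=> [[_ //]|]; split=> //; exact: tr_theta_mx. Qed.

Section SosCadj.
Variables (R : realType) (n : nat).

Lemma sos_sum_sqr : is_sos (\sum_(i < n) 'X_i ^+ 2 : {mpoly R[n]}).
Proof. by apply: sos_sum => i _; apply: sos_sqr. Qed.

Lemma sos_cadj_form (G : sgraph n) :
  is_sos (cadj_form G (fun i => 'X_i ^+ 2 : {mpoly R[n]})).
Proof.
apply: sos_sum => i _; apply: sos_sum => j _.
rewrite -mpolyC_nat; do 2![apply: sosM; last exact: sos_sqr].
by apply: sosC; rewrite ler0n.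
Qed.

(** Raising r multiplies by a power of the sum of squares; raising t adds a multiple of [cadj_form],
    whose coefficients are nonnegative. This brings all the graphs H_i + i to a common r and t. *)
Lemma Kcone_theta_mx_le (G : sgraph n) r r' (t t' : R) :
  (r <= r')%N -> t <= t' ->
  Kcone r (theta_mx G t) -> Kcone r' (theta_mx G t').
Proof.
move=> le_r le_t /Kcone_theta_mxE; rewrite Kcone_theta_mxE !kpoly_theta_mx.
move=> sosG; rewrite -(subnK le_r) -(subrK t t') exprD rmorphD /= mulrDl -addrA.
rewrite mulrDr -mulrA; apply: sosD; last first.
  by rewrite -mulrA; apply: sosM => //; apply/sosX/sos_sum_sqr.
do 2![apply: sosM; first exact/sosX/sos_sum_sqr].
by apply: sosM; [apply: sosC; rewrite subr_ge0 | exact: sos_cadj_form].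
Qed.

End SosCadj.

(** * Induced subgraphs, isolated nodes and the cubic identity *)

Section Induced.
Variables (n : nat) (G : sgraph n) (A : {pred 'I_n}).

Definition induced_adj : rel 'I_#|A| := fun a b => adj G (enum_val a) (enum_val b).

Lemma induced_sym : ssrbool.symmetric induced_adj.
Proof. by move=> a b; apply: adj_sym. Qed.

Lemma induced_irr : irreflexive induced_adj.
Proof. by move=> a; apply: adj_irr. Qed.

Definition induced : sgraph #|A| := SGraph induced_sym induced_irr.

Lemma cadj_induced a b : cadj induced a b = cadj G (enum_val a) (enum_val b).
Proof. by rewrite /cadj /= (inj_eq enum_val_inj). Qed.

End Induced.

Lemma adj_add_isolated n (G : sgraph n) i j :
  adj (add_isolated G) (lift ord_max i) (lift ord_max j) = adj G i j.
Proof. by rewrite /= /add_isolated_adj !liftK. Qed.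

Lemma cadj_form_add_isolated n (T : comNzRingType) (G : sgraph n) (y : 'I_n.+1 -> T) :
  cadj_form (add_isolated G) y =
  y ord_max ^+ 2 + cadj_form G (fun i => y (lift ord_max i)).
Proof.
have cadjl i : cadj (add_isolated G) (lift ord_max i) ord_max = false.
  by rewrite /cadj eq_sym (negPf (neq_lift _ _)) /= /add_isolated_adj liftK unlift_none.
have cadjll i j : cadj (add_isolated G) (lift ord_max i) (lift ord_max j) = cadj G i j.
  by rewrite /cadj (inj_eq lift_inj) adj_add_isolated.
rewrite /cadj_form (bigD1_ord ord_max) // (bigD1_ord ord_max) // big1 => [|i _].
  rewrite {1}/cadj eqxx mul1r -expr2 Monoid.mulm1; congr (_ + _); apply: eq_bigr => i _.
  rewrite (bigD1_ord ord_max) // cadjl !mul0r Monoid.mul1m.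
  by apply: eq_bigr => j _; rewrite cadjll.
by rewrite cadjC cadjl !mul0r.
Qed.

(* Once everything is expanded over triples (i, j, k), this says that the sum of
   y_i y_j y_k over the paths on i, j, k does not depend on which index is the
   middle vertex. *)
Lemma sum_closed_nbhd (T : comNzRingType) n (c : rel 'I_n) (y : 'I_n -> T) :
  ssrbool.symmetric c ->
  (\sum_i y i) * (\sum_j \sum_k (c j k)%:R * y j * y k) =
  \sum_i y i * ((\sum_(j | c i j) y j) ^+ 2 +
     \sum_(j | ~~ c i j) \sum_(k | ~~ c i k) (c j k)%:R * y j * y k) +
  \sum_i \sum_j \sum_k ([&& c i j, c i k & ~~ c j k])%:R * y i * y j * y k.
Proof.
move=> c_sym.
pose S (w : 'I_n -> 'I_n -> 'I_n -> T) :=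
  \sum_i \sum_j \sum_k w i j k * y i * y j * y k.
have SD w w' : S w + S w' = S (fun i j k => w i j k + w' i j k).
  rewrite /S -big_split; apply: eq_bigr => i _; rewrite -big_split.
  apply: eq_bigr => j _; rewrite -big_split; apply: eq_bigr => k _ /=.
  by ring.
have eqS w w' : (forall i j k, w i j k = w' i j k) -> S w = S w'.
  by move=> eq_w; do 3!apply: eq_bigr => ? _; rewrite eq_w.
(* Weight of the paths with middle vertex [i]; [S12] and [S13] move the middle to [j] and to [k] by
   renaming indices. *)
pose p i j k : T := (c i j)%:R * (c i k)%:R.
have S12 : S (fun i j k => (c i j)%:R * (c j k)%:R) = S p.
  rewrite /S exchange_big; do 3!apply: eq_bigr => ? _.
  by rewrite /p c_sym; ring.
have S13 : S (fun i j k => (c i k)%:R * (c j k)%:R) = S p.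
  under [LHS]eq_bigr => i _ do rewrite exchange_big.
  rewrite exchange_big /S /p.
  under [RHS]eq_bigr => i _ do rewrite exchange_big.
  do 3!apply: eq_bigr => ? _.
  by rewrite c_sym [c _ _ in X in _ * X * _ * _ * _]c_sym; ring.
have -> : (\sum_i y i) * (\sum_j \sum_k (c j k)%:R * y j * y k) =
    S (fun i j k => (c j k)%:R).
  rewrite mulr_suml; apply: eq_bigr => i _; rewrite mulr_sumr.
  apply: eq_bigr => j _; rewrite mulr_sumr; apply: eq_bigr => k _; ring.
have -> : \sum_i y i * ((\sum_(j | c i j) y j) ^+ 2 +
     \sum_(j | ~~ c i j) \sum_(k | ~~ c i k) (c j k)%:R * y j * y k) =
    S (fun i j k => p i j k + (~~ c i j)%:R * (~~ c i k)%:R * (c j k)%:R).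
  apply: eq_bigr => i _; rewrite expr2 mulr_suml big_mkcond.
  rewrite [X in _ + X]big_mkcond -big_split mulr_sumr; apply: eq_bigr => j _ /=.
  rewrite [\sum_(k | c i k) _]big_mkcond [\sum_(k | ~~ c i k) _]big_mkcond.
  rewrite /p; case: (c i j) => /=.
    rewrite addr0 !mulr_sumr; apply: eq_bigr => k _.
    by case: (c i k); rewrite /=; ring.
  rewrite add0r !mulr_sumr; apply: eq_bigr => k _.
  by case: (c i k); rewrite /=; ring.
rewrite -/(S (fun i j k => ([&& c i j, c i k & ~~ c j k])%:R)) SD.
(* Two path sums are added to both sides; on the right they are rewritten with middle vertices [j]
   and [k]. The weights then agree for each triple, in all eight truth cases. *)
apply: (addIr (S p + S p)); rewrite -{3}S12 -{3}S13 !SD.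
apply: eqS => i j k; rewrite /p.
by case: (c i j); case: (c i k); case: (c j k); rewrite /=; ring.
Qed.

(** * Non-neighbours of a node, and the passage from r to r + 1 *)

Definition non_nbrs n (G : sgraph n) (i : 'I_n) := induced G [pred j | ~~ cadj G i j].

Lemma big_nbrs_non_nbrs n (T : comNzRingType) (G : sgraph n) i (y : 'I_n -> T) :
  \sum_(j | cadj G i j) y j + \sum_(a < #|[pred j | ~~ cadj G i j]|) y (enum_val a) =
  \sum_j y j.
Proof. rewrite [RHS](bigID (cadj G i)); congr (_ + _).
by rewrite -big_enum_val. Qed.

Lemma cadj_form_non_nbrs n (T : comNzRingType) (G : sgraph n) i (y : 'I_n -> T) :
  cadj_form (non_nbrs G i) (fun a => y (enum_val a)) =
  \sum_(j | ~~ cadj G i j) \sum_(k | ~~ cadj G i k) (cadj G j k)%:R * y j * y k.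
Proof.
rewrite [RHS](big_enum_val (A := [pred j | ~~ cadj G i j])); apply: eq_bigr => a _.
rewrite [RHS](big_enum_val (A := [pred k | ~~ cadj G i k])); apply: eq_bigr => b _.
by rewrite cadj_induced.
Qed.

(** One factor s of s^(r+1) is spent on [sum_closed_nbhd]; the remaining s^r belongs to each local
    form, whose substituted variables again sum to s. Nonnegativity of t makes the residual cubic
    term a sum of squares. *)
Lemma Kcone_theta_mx_step (R : realType) n (G : sgraph n) r (t : R) :
  0 <= t ->
  (forall i, Kcone r (theta_mx (add_isolated (non_nbrs G i)) t)) ->
  Kcone r.+1 (theta_mx G t).
Proof.
move=> t_ge0 KH; rewrite Kcone_theta_mxE kpoly_theta_mx.
set y := fun i : 'I_n => 'X_i ^+ 2 : {mpoly R[n]}; set s := \sum_i y i.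
pose z i (a : 'I_#|[pred j | ~~ cadj G i j]|.+1) : {mpoly R[n]} :=
  if unlift ord_max a is Some b then y (enum_val b)
  else \sum_(j | cadj G i j) y j.
pose N := \sum_i \sum_j \sum_k
  ([&& cadj G i j, cadj G i k & ~~ cadj G j k])%:R * y i * y j * y k.
have zl i b : z i (lift ord_max b) = y (enum_val b) by rewrite /z liftK.
have zm i : z i ord_max = \sum_(j | cadj G i j) y j by rewrite /z unlift_none.
have zE i : kpoly (@mpolyC n R) r (theta_mx (add_isolated (non_nbrs G i)) t) (z i) =
    s ^+ r * (t%:MP * ((\sum_(j | cadj G i j) y j) ^+ 2 +
      \sum_(j | ~~ cadj G i j) \sum_(k | ~~ cadj G i k) (cadj G j k)%:R * y j * y k)
      - s ^+ 2).
  rewrite kpoly_theta_mx cadj_form_add_isolated zm -cadj_form_non_nbrs.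
  have -> : \sum_a z i a = s.
    rewrite (bigD1_ord ord_max) // zm /s -(big_nbrs_non_nbrs G i).
    by congr (_ + _); apply: eq_bigr => b _; rewrite zl.
  suff -> : cadj_form (non_nbrs G i) (fun a => z i (lift ord_max a)) =
      cadj_form (non_nbrs G i) (fun a => y (enum_val a)) by [].
  by apply: eq_bigr => a _; apply: eq_bigr => b _; rewrite !zl.
have -> : s ^+ r.+1 * (t%:MP * cadj_form G y - s ^+ 2) =
    \sum_i y i * kpoly (@mpolyC n R) r (theta_mx (add_isolated (non_nbrs G i)) t) (z i)
    + s ^+ r * t%:MP * N.
  have key := sum_closed_nbhd y (@cadjC _ G); rewrite -/(cadj_form G y) -/s -/N in key.
  under eq_bigr => i _ do rewrite zE.
  transitivity (s ^+ r * (t%:MP * (s * cadj_form G y) - s * s ^+ 2)).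
    by rewrite exprS; ring.
  set A := (X in _ = X + N) in key; rewrite key.
  transitivity (s ^+ r * (t%:MP * A - s * s ^+ 2) + s ^+ r * t%:MP * N); first by ring.
  (* Expanding one s in s * s^2 as the sum of the y_i gives each local form its own -s^2. *)
  congr (_ + _); rewrite {2}/s /A mulr_suml !mulr_sumr -sumrB mulr_sumr.
  by apply: eq_bigr => i _; ring.
apply: sosD.
  apply: sos_sum => i _; apply: sosM; first exact: sos_sqr.
  apply: (sos_kpoly_subst (f := fun b => 'X_(enum_val b))) => [b||].
  - by rewrite zl.
  - by rewrite zm; apply: sos_sum => j _; apply: sos_sqr.
  - exact/Kcone_theta_mxE/KH.
apply: sosM; first by apply: sosM; [exact/sosX/sos_sum_sqr | exact: sosC].
do 3!apply: sos_sum => ? _; rewrite -mpolyC_nat.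
do 3![apply: sosM; last exact: sos_sqr].
by apply: sosC; rewrite ler0n.
Qed.

(** * Stable sets and comparison of stability numbers *)

Section StabilityNumber.
Variables (n : nat) (G : sgraph n).

Lemma stableP (S : {set 'I_n}) :
  reflect {in S &, forall i j, ~~ adj G i j} (stable G S).
Proof.
apply: (iffP forall_inP) => [stS i j iS jS|stS i iS].
  exact: (forall_inP (stS i iS)).
by apply/forall_inP => j; apply: stS.
Qed.

Lemma stable_le_alpha (S : {set 'I_n}) : stable G S -> (#|S| <= alpha G)%N.
Proof. exact: (@leq_bigmax_cond _ (stable G) (fun S : {set 'I_n} => #|S|)). Qed.

Lemma stable_set0 : stable G finset.set0.
Proof. by apply/stableP => i j; rewrite inE. Qed.

Lemma alpha_stable : {S : {set 'I_n} | stable G S & #|S| = alpha G}.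
Proof.
have [|S stS alphaE] := @eq_bigmax_cond _ (stable G) (fun S : {set 'I_n} => #|S|).
  by apply/card_gt0P; exists finset.set0; apply: stable_set0.
by exists S.
Qed.

Lemma alpha_gt0 : (0 < n)%N -> (0 < alpha G)%N.
Proof.
move=> n_gt0; pose i := Ordinal n_gt0.
rewrite -(cards1 i); apply: stable_le_alpha.
by apply/stableP => j k; rewrite !inE => /eqP-> /eqP->; rewrite adj_irr.
Qed.

End StabilityNumber.

Lemma alpha_le m n (H : sgraph m) (G : sgraph n) (g : 'I_m -> 'I_n) :
  injective g -> (forall a b, adj G (g a) (g b) -> adj H a b) ->
  (alpha H <= alpha G)%N.
Proof.
move=> g_inj gadj; have [S /stableP stS <-] := alpha_stable H.
rewrite -(card_imset (mem S) g_inj); apply: stable_le_alpha.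
apply/stableP => _ _ /imsetP[a aS ->] /imsetP[b bS ->].
by apply: contra (stS a b aS bS); apply: gadj.
Qed.

(** Sending the new node to [i] itself keeps stable sets stable, since every other node of the
    smaller graph is a non-neighbour of [i]. *)
Lemma alpha_add_isolated_non_nbrs n (G : sgraph n) i :
  (alpha (add_isolated (non_nbrs G i)) <= alpha G)%N.
Proof.
pose g (a : 'I_#|[pred j | ~~ cadj G i j]|.+1) :=
  if unlift ord_max a is Some b then enum_val b else i.
have nbr (b : 'I_#|[pred j | ~~ cadj G i j]|) : ~~ cadj G i (enum_val b).
  exact: (enum_valP b).
apply: (@alpha_le _ _ _ _ g) => [a b|a b]; rewrite /g.
- case: unliftP => [a'|] ->; case: unliftP => [b'|] -> //.
  + by move/enum_val_inj->.
  + by move=> eq_i; have := nbr a'; rewrite eq_i /cadj eqxx.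
  + by move=> eq_i; have := nbr b'; rewrite -eq_i /cadj eqxx.
- case: unliftP => [a'|] ->; case: unliftP => [b'|] ->.
  + by rewrite adj_add_isolated.
  + by move=> adj_i; have := nbr a'; rewrite /cadj adj_sym adj_i orbT.
  + by move=> adj_i; have := nbr b'; rewrite /cadj adj_i orbT.
  + by rewrite adj_irr.
Qed.

(** * Finite rank as membership in some cone at t = alpha(G) *)

Section FiniteRank.
Variables (R : realType) (n : nat) (G : sgraph n).
Hypothesis n_gt0 : (0 < n)%N.

(** At the indicator vector of a maximum stable set, with a = alpha(G), the form takes the value a^r
    (t a - a^2), which must be nonnegative. *)
Lemma Kcone_theta_mx_ge r (t : R) : Kcone r (theta_mx G t) -> (alpha G)%:R <= t.
Proof.
have [S /stableP stS cardS] := alpha_stable G.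
have a_gt0 : 0 < (alpha G)%:R :> R by rewrite ltr0n alpha_gt0.
move=> /Kcone_theta_mxE/(sos_meval_ge0 (fun i => (i \in S)%:R)).
pose v i : R := (i \in S)%:R.
have sum_v : \sum_i v i = (alpha G)%:R.
  rewrite -cardS -sum1_card natr_sum [RHS]big_mkcond.
  by apply: eq_bigr => i _; rewrite /v; case: (i \in S).
have -> : (kpoly (@mpolyC n R) r (theta_mx G t) (fun i => 'X_i ^+ 2)).@[v] =
    kpoly idfun r (theta_mx G t) v.
  rewrite rmorph_kpoly; apply: eq_kpoly => [a|i] /=; first exact: mevalC.
  by rewrite rmorphXn /= mevalXU /v; case: (i \in S); rewrite ?expr1n ?expr0n.
rewrite kpoly_theta_mx /= sum_v.
(* On a stable set only the diagonal terms survive. *)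
have -> : cadj_form G v = (alpha G)%:R.
  rewrite -sum_v; apply: eq_bigr => i _; rewrite (bigD1 i) //= big1 => [|j ji].
    by rewrite /cadj eqxx mul1r /v; case: (i \in S); rewrite ?mulr1 ?mulr0 addr0.
  rewrite /v /cadj eq_sym (negPf ji) /=.
  have [iS|_] := boolP (i \in S); last by rewrite mulr0 mul0r.
  have [jS|_] := boolP (j \in S); last by rewrite mulr0.
  by rewrite (negPf (stS i j iS jS)) !mul0r.
by rewrite pmulr_rge0 ?exprn_gt0 // expr2 -mulrBl pmulr_lge0 // subr_ge0.
Qed.

Lemma theta_eq_alphaP r :
  theta R r G = (alpha G)%:R <-> Kcone r (theta_mx G ((alpha G)%:R : R)).
Proof.
rewrite /theta /minimum; split=> [|KG].
  (* Without a least element [theta] would be the default 0, but alpha(G) is positive. *)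
  case: xgetP => [x -> [Kx _] <- //|_ /esym/eqP].
  by rewrite pnatr_eq0 -leqn0 leqNgt alpha_gt0.
apply: xget_unique => [|t [Kt lbt]].
  by split=> // t; apply: Kcone_theta_mx_ge.
apply/le_anti/andP; split; first exact: lbt.
exact: Kcone_theta_mx_ge Kt.
Qed.

Lemma finite_theta_rankP :
  finite_theta_rank R G <-> exists r, Kcone r (theta_mx G ((alpha G)%:R : R)).
Proof.
rewrite /finite_theta_rank /theta_rank /least_nat.
case: pselect => [ex|nex]; split=> //.
- by move=> _; have [r /asboolP/theta_eq_alphaP] := ex; exists r.
- by move=> [r /theta_eq_alphaP Kr]; case: nex; exists r; apply/asboolP.
Qed.

End FiniteRank.

Lemma Kcone_theta_mx1 (R : realType) (G : sgraph 1) (t : R) :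
  1 <= t -> Kcone 0 (theta_mx G t).
Proof.
move=> t_ge1; rewrite Kcone_theta_mxE /kpoly expr0 mul1r !big_ord1.
rewrite theta_mxE /cadj eqxx mulr1.
by apply: sosM (sos_sqr _); apply: sosM (sos_sqr _); apply: sosC; rewrite subr_ge0.
Qed.

(** There are finitely many nodes, so the maximum of the chosen exponents serves for all of them; t
    is then raised to alpha(G). *)
Lemma finite_theta_rank_non_nbrs (R : realType) n (G : sgraph n) : (0 < n)%N ->
  (forall i, finite_theta_rank R (add_isolated (non_nbrs G i))) ->
  finite_theta_rank R G.
Proof.
move=> n_gt0 finH; apply/finite_theta_rankP => //.
have [r Kr] := choice (fun i => (finite_theta_rankP R _ (ltn0Sn _)).1 (finH i)).
exists (\max_i r i).+1; apply: Kcone_theta_mx_step => [|i]; first exact: ler0n.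
apply: Kcone_theta_mx_le (Kr i); first exact: leq_bigmax.
by rewrite ler_nat alpha_add_isolated_non_nbrs.
Qed.

Theorem proposition4p6 (R : realType) :
  (forall (n : nat) (G : sgraph n), (0 < n)%N -> finite_theta_rank R G)
  <->
  (forall (n : nat) (G : sgraph n), (0 < n)%N ->
     finite_theta_rank R G -> finite_theta_rank R (add_isolated G)).
Proof.
split=> [fin n G _ _|fin_add n]; first exact: fin.
elim/ltn_ind: n => n IHn G n_gt0; apply: finite_theta_rank_non_nbrs => // i.
have : (#|[pred j | ~~ cadj G i j]| < n)%N.
  rewrite -[ltnRHS]card_ord -(cardC (cadj G i)) -[ltnLHS]add0n ltn_add2r.
  by apply/card_gt0P; exists i; rewrite unfold_in /cadj eqxx.
(* If [i] has no non-neighbours, then H_i is empty and outside the scope of (2); H_i + i is a single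
   node, handled directly with r = 0. *)
move: (non_nbrs G i); move: #|_| => [|m] H lt_mn; last first.
  by apply: fin_add => //; apply: IHn.
apply/finite_theta_rankP => //; exists 0%N; apply: Kcone_theta_mx1.
by rewrite ler1n alpha_gt0.
Qed.
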